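(* Let $u_0$ be a given $2L$-periodic function and suppose that the solution $u$, $2L$-periodic in $x$, of $$\partial_t u+\partial_x\Big(\frac{u^2}{2}-\partial_x u+\mathcal{J}[u]\Big)=0\quad (x\in\mathbf{R},\ t\in(0,T)),\qquad u(0,\cdot)=u_0,$$ is (sufficiently) smooth. For each $h$, let $u_h^0\in\mathcal{S}_h^r$ satisfy $\|u_h^0-u_0\|\le C_0h^{r-1}$ with $C_0$ independent of $h$. Then there exists $\delta>0$, independent of $h$ and $\Delta t$, such that if $\Delta t$, $h$, $\Delta t^5h^{-1/2}$ and $\Delta t\,h^{2r-3/2}$ are all less than $\delta$, then there is at most one sequence $U^0,\dots,U^N\in\mathcal{S}_h^r$ with $U^0=u_h^0$ and $$(\partial U^n,\chi)+(U^{n+1/2}U_x^{n+1/2},\chi)+(U_x^{n+1/2},\chi')-(\mathcal{J}[U^{n+1/2}],\chi')=0\qquad\forall\chi\in\mathcal{S}_h^r,\ n=0,\dots,N-1 .$$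
   Context: Fix $L>0$, $T>0$. All functions are real-valued. For real $s\ge 0$, $H^s_{per}$ is the Sobolev space of $2L$-periodic functions on $\mathbf{R}$ of order $s$, with norm $\|\cdot\|_s$ over one period; $\|\cdot\|$ and $(\cdot,\cdot)$ are the norm and inner product of $L^2(-L,L)$, and $\|\cdot\|_\infty$ is the sup norm. Subscript $x$ and prime denote spatial derivatives. Nonlocal operator (with the integral truncated to $(0,L)$): $\mathcal{J}[\varphi](x)=\int_0^{L}|\xi|^{-1/3}\varphi'(x-\xi)\,d\xi$. Finite element spaces: $r\ge 2$ is an integer. For a partition $-L=x_0<x_1<\dots<x_M=L$ with $h=\max_j(x_{j+1}-x_j)$, $\mathcal{S}_h^r$ is a finite-dimensional subspace of $H^1_{per}$ consisting of continuously differentiable $2L$-periodic piecewise polynomial functions of degree $r-1$. The family $(\mathcal{S}_h^r)$ is assumed to satisfy, for small $h$, $\inf_{\chi\in\mathcal{S}_h^r}\{\|v-\chi\|+h\|(v-\chi)'\|\}\le C h^s\|v\|_s$ for all $v\in H^s_{per}$, $1\le s\le r$, with $C$ independent of $h$ and $v$, and the inverse inequality $\|\chi\|_\infty\le C h^{-1/2}\|\chi\|$ for all $\chi\in\mathcal{S}_h^r$. Time grid: $N\in\mathbf{N}$, $\Delta t=T/N$, $\partial U^n=(U^{n+1}-U^n)/\Delta t$, $U^{n+1/2}=(U^n+U^{n+1})/2$. ''Smooth'' means of class $C^m$ on $[0,T]\times\mathbf{R}$ for a sufficiently large integer $m$ depending only on $r$. *)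

(* Defs.v *)
From HB Require Import structures.
From mathcomp Require Import all_boot all_order all_algebra.
From mathcomp Require Import all_classical all_reals all_analysis.

Set Implicit Arguments.
Unset Strict Implicit.
Unset Printing Implicit Defensive.

Import Order.TTheory GRing.Theory Num.Theory.
Import numFieldNormedType.Exports.

Local Open Scope classical_set_scope.
Local Open Scope ring_scope.

(* L^2(-L,L), with functions on the whole line as representatives. *)
Definition inL2 (R : realType) (L : R) (f : R -> R) : Prop :=
  measurable_fun `]-L, L[ f /\
  (@lebesgue_measure R).-integrable `]-L, L[ (fun x => (f x ^+ 2)%:E).

Definition ip (R : realType) (L : R) (f g : R -> R) : R :=
  \int[@lebesgue_measure R]_(x in `]-L, L[) (f x * g x).

Definition norm2 (R : realType) (L : R) (f : R -> R) : R :=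
  Num.sqrt (ip L f f).

Definition supnorm (R : realType) (f : R -> R) : R :=
  sup (range (fun x => `|f x|)).

(* With \hat v(k) = (2L)^-1 \int_{-L}^L v(x) e^{-i pi k x / L} dx, this is
   2L |\hat v(k)|^2 for real-valued v. *)
Definition fourier_energy (R : realType) (L : R) (v : R -> R) (k : nat) : R :=
  (ip L v (fun x => cos (pi * k%:R * x / L)) ^+ 2 +
   ip L v (fun x => sin (pi * k%:R * x / L)) ^+ 2) / (2 * L).

(* \sum_{k in Z} (1 + (pi k / L)^2)^s 2L |\hat v(k)|^2; for real-valued v the
   frequencies k and -k contribute equally, hence the factor 2 for k > 0.
   With this normalization the norm of order 0 is the L^2(-L,L) norm. *)
Definition sobolev_sum (R : realType) (L s : R) (v : R -> R) : \bar R :=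
  (\sum_(0 <= k <oo) ((if k == 0%N then 1 else 2) *
     (1 + (pi * k%:R / L) ^+ 2) `^ s * fourier_energy L v k)%:E)%E.

Definition inHper (R : realType) (L s : R) (v : R -> R) : Prop :=
  [/\ periodic v (2 * L), inL2 L v & (sobolev_sum L s v < +oo)%E].

Definition normHper (R : realType) (L s : R) (v : R -> R) : R :=
  Num.sqrt (fine (sobolev_sum L s v)).

(* g is the distributional derivative of the 2L-periodic function v, tested
   against all 2L-periodic functions of class C^oo. *)
Definition weak_derivative (R : realType) (L : R) (v g : R -> R) : Prop :=
  inL2 L g /\
  forall phi : R -> R, periodic phi (2 * L) ->
    (forall (k : nat) (x : R), derivable (derive1n k phi) x 1) ->
    ip L v (derive1 phi) = - ip L g phi.

Definition Jop (R : realType) (L : R) (phi : R -> R) (x : R) : R :=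
  \int[@lebesgue_measure R]_(xi in `]0, L[)
     (`|xi| `^ (- 3^-1) * derive1 phi (x - xi)).

(* A partition -L = x_0 < x_1 < ... < x_M = L is given by the sequence
   [:: x_1; ...; x_M], as in itv_partition. *)
Definition node (R : realType) (L : R) (P : seq R) (j : nat) : R :=
  nth 0 (- L :: P) j.

Definition mesh (R : realType) (L : R) (P : seq R) : R :=
  \big[Num.max/0]_(j < size P) (node L P j.+1 - node L P j).

Definition is_C1 (R : realType) (f : R -> R) : Prop :=
  (forall x : R, derivable f x 1) /\ continuous (derive1 f).

Definition piecewise_poly (R : realType) (L : R) (r : nat) (P : seq R)
    (f : R -> R) : Prop :=
  forall j : nat, (j < size P)%N ->
    exists2 p : {poly R}, (size p <= r)%N &
      forall x : R, node L P j <= x <= node L P j.+1 -> f x = p.[x].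

Definition finite_dim_subspace (R : realType) (S : set (R -> R)) : Prop :=
  exists (d : nat) (b : 'I_d -> R -> R),
    S = [set f | exists c : 'I_d -> R,
                   f = (fun x => \sum_(k < d) c k * b k x)].

Definition fe_space (R : realType) (L : R) (r : nat) (P : seq R)
    (S : set (R -> R)) : Prop :=
  [/\ itv_partition (- L) L P,
      finite_dim_subspace S,
      S `<=` inHper L 1 &
      forall chi : R -> R, S chi ->
        [/\ is_C1 chi, periodic chi (2 * L) & piecewise_poly L r P chi]].

(* The derivative of v is the weak one, the derivative of chi the classical
   one. *)
Definition approximation_property (R : realType) (L : R) (r : nat) (I : Type)
    (P : I -> seq R) (S : I -> set (R -> R)) : Prop :=
  exists2 h0 : R, 0 < h0 &
  forall s : R, 1 <= s <= r%:R ->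
  exists2 C : R, 0 < C &
  forall (i : I) (v v' : R -> R), mesh L (P i) < h0 ->
    inHper L s v -> weak_derivative L v v' ->
    inf [set norm2 L (fun x => v x - chi x) +
             mesh L (P i) * norm2 L (fun x => v' x - derive1 chi x)
        | chi in S i] <= C * mesh L (P i) `^ s * normHper L s v.

Definition inverse_inequality (R : realType) (L : R) (I : Type)
    (P : I -> seq R) (S : I -> set (R -> R)) : Prop :=
  exists h0 C : R, [/\ 0 < h0, 0 < C &
    forall (i : I) (chi : R -> R), mesh L (P i) < h0 -> S i chi ->
      supnorm chi <= C * mesh L (P i) `^ (- 2^-1) * norm2 L chi].

(* u is of class C^m on [0,T] x R: its partial derivatives
   D i j = \partial_t^i \partial_x^j u, i + j <= m, exist on ]0,T[ x R and extend
   continuously to [0,T] x R. *)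
Definition smooth_upto (R : realType) (T : R) (m : nat) (u : R -> R -> R)
    : Prop :=
  exists D : nat -> nat -> R -> R -> R,
  [/\ forall t x : R, 0 <= t <= T -> D 0%N 0%N t x = u t x,
      forall i j : nat, (i + j <= m)%N ->
        {within [set z : R * R | 0 <= z.1 <= T],
          continuous (fun z : R * R => D i j z.1 z.2)} &
      forall i j : nat, (i + j < m)%N -> forall t x : R, 0 < t < T ->
        is_derive t 1 (fun t' : R => D i j t' x) (D i.+1 j t x) /\
        is_derive x 1 (D i j t) (D i j.+1 t x)].

Definition is_solution (R : realType) (L T : R) (u0 : R -> R)
    (u : R -> R -> R) : Prop :=
  [/\ forall t : R, 0 <= t <= T -> periodic (u t) (2 * L),
      forall t x : R, 0 < t < T ->
        derive1 (fun t' : R => u t' x) t +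
        derive1 (fun y : R => u t y ^+ 2 / 2 - derive1 (u t) y + Jop L (u t) y)
          x = 0 &
      u 0 = u0].

Definition half_step (R : realType) (U : nat -> R -> R) (n : nat) : R -> R :=
  fun x => (U n x + U n.+1 x) / 2.

Definition scheme_solution (R : realType) (L dt : R) (N : nat)
    (S : set (R -> R)) (uh0 : R -> R) (U : nat -> R -> R) : Prop :=
  [/\ forall n : nat, (n <= N)%N -> S (U n),
      U 0%N = uh0 &
      forall n : nat, (n < N)%N -> forall chi : R -> R, S chi ->
        ip L (fun x => (U n.+1 x - U n x) / dt) chi +
        ip L (fun x => half_step U n x * derive1 (half_step U n) x) chi +
        ip L (derive1 (half_step U n)) (derive1 chi) -
        ip L (Jop L (half_step U n)) (derive1 chi) = 0].

(* Main.v *)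
(** The scheme is stable in [L^2] for small time steps whatever the regularity of
    the exact solution, and stability alone forces uniqueness.

    Write [Q f = (f, f)].  On [2 L]-periodic [C^1] functions, Agmon's inequality
    bounds [sup f ^ 2] by [eta * Q f' + C * Q f] for every [eta > 0].  Splitting
    the integral defining [J] at a small [a], with Cauchy-Schwarz on [(0, a)]
    (the kernel is square integrable) and an integration by parts on [(a, L)],
    gives a bound of the same shape for [sup (J f) ^ 2], whence
    [|(J f, f')| <= Q f' / 2 + K * Q f].

    Testing with [U^(n+1/2)] kills the quadratic term, so discrete Gronwall bounds
    every solution of the scheme in [L^2] by some [M], independently of [h] and of
    the time step.  If two solutions agree at step [n], test the difference of
    their equations with [e = U^(n+1/2) - V^(n+1/2)]: the quadratic terms
    contribute only [- \int V e e'], which Agmon's inequality and the bound on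
    [Q V] control by [Q e' / 2 + C * Q e].  The dissipation [Q e'] absorbs both
    nonlocal and quadratic terms, leaving [(2 / dt) * Q e <= C' * Q e], hence
    [e = 0] as soon as [dt * C' < 2]. *)

Require Import Defs.
From HB Require Import structures.
From mathcomp Require Import all_boot all_order all_algebra.
From mathcomp Require Import all_classical all_reals all_analysis.
From mathcomp Require Import measurable_realfun ring lra.

Import Order.TTheory GRing.Theory Num.Theory.
Import numFieldNormedType.Exports.

Local Open Scope classical_set_scope.
Local Open Scope ring_scope.

(** * Integration of continuous functions *)

Section integration.
Context {R : realType}.
Notation mu := (@lebesgue_measure R).
Implicit Types (f g F : R -> R) (a b x : R).

Lemma is_derive_reflect x a : is_derive a 1 (fun y : R => x - y) (-1 : R).
Proof. by rewrite -[-1]sub0r; apply: is_deriveB. Qed.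

Lemma is_derive_shift x a : is_derive a 1 (fun y : R => y - x) (1 : R).
Proof. by rewrite -[X in is_derive _ _ _ X]subr0; apply: is_deriveB. Qed.

Lemma integrable_scale (D : set (measurableTypeR R)) f k : measurable D ->
  mu.-integrable D (EFin \o f) -> mu.-integrable D (EFin \o (fun x => k * f x)).
Proof.
move=> mD If; apply: (eq_integrable mD _ _ _ (integrableZl mD k If)) => x _ /=.
by rewrite EFinM.
Qed.

Lemma continuous_integrable f (ba bb : bool) a b : continuous f ->
  mu.-integrable [set` Interval (BSide ba a) (BSide bb b)] (EFin \o f).
Proof.
move=> cf; have sub : [set` Interval (BSide ba a) (BSide bb b)] `<=` `[a, b].
  by apply: subset_itvScc; rewrite ?bnd_simp; case: ba; case: bb.
apply: (@integrableS _ _ R mu `[a, b] _ _ _ _ sub); try exact: measurable_itv.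
apply: continuous_compact_integrable; first exact: segment_compact.
exact: continuous_subspaceT.
Qed.

Lemma Rintegral_derivative F f a b : a <= b -> continuous f ->
  (forall x, is_derive x 1 F (f x)) ->
  \int[mu]_(x in `]a, b[) f x = F b - F a.
Proof.
move=> ab cf dF.
rewrite le_eqVlt in ab; case/orP: ab => [/eqP <-|ab].
  by rewrite set_itvoo0 Rintegral_set0 subrr.
rewrite Rintegral_itv_bndo_bndc; last exact: continuous_integrable.
rewrite Rintegral_itv_obnd_cbnd; last exact: continuous_integrable.
have cF : continuous F.
  move=> x; apply: differentiable_continuous; apply/derivable1_diffP.
  exact: ex_derive.
rewrite /Rintegral (@continuous_FTC2 _ f F)//.
- exact: continuous_subspaceT.
- split; first by move=> x _; exact: ex_derive.
  + exact/cvg_at_right_filter/cF.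
  + exact/cvg_at_left_filter/cF.
- by move=> x _; rewrite derive1E; exact: derive_val.
Qed.

(** No fixed base point lies to the left of every x, so the integral is normalised to vanish at 0.
    Then [P a x] is independent of [a] as long as [a] lies below both 0 and x, and the base point
    may move with x. *)
Lemma primitive_exists f : continuous f ->
  exists F, forall x, is_derive x 1 F (f x).
Proof.
move=> cf.
pose P a x := \int[mu]_(t in `[a, x]) f t - \int[mu]_(t in `[a, 0]) f t.
have indep a b x : a < b -> b < x -> b < 0 -> P a x = P b x.
  move=> ab bx b0; rewrite /P.
  have E z : b < z -> \int[mu]_(t in `[a, z]) f t =
    \int[mu]_(t in `[a, b]) f t + \int[mu]_(t in `[b, z]) f t.
    move=> bz; have := @Rintegral_itvB R f (BLeft a) (BRight z) b
      (continuous_integrable _ _ _ _ _ cf).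
    rewrite !bnd_simp => /(_ (ltW ab) (ltW bz)).
    by rewrite Rintegral_itv_obnd_cbnd; [lra|exact: continuous_integrable].
  by rewrite (E x)// (E 0)//; ring.
exists (fun x => P (Num.min x 0 - 1) x) => x.
(* A base point frozen near x: for z within 1 of x the moving base point [Num.min z 0 - 1] is at
   least [Num.min x 0 - 2], hence above [a], and [indep] applies. *)
pose a := Num.min x 0 - 3.
have mx : Num.min x 0 <= x by rewrite ge_min lexx.
have m0 : Num.min x 0 <= 0 by rewrite ge_min lexx orbT.
apply: (@near_eq_is_derive _ _ _ (P a)).
  have : \forall z \near x, `|z - x| < 1.
    by apply: (@cvgr_distC_lt _ _ _ _ _ id x cvg_id).
  apply: filterS => z; rewrite ltr_norml => /andP[z1 z2].
  have : Num.min x 0 - 1 <= Num.min z 0.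
    by rewrite le_min; apply/andP; split; lra.
  have : Num.min z 0 <= z by rewrite ge_min lexx.
  have : Num.min z 0 <= 0 by rewrite ge_min lexx orbT.
  by move=> *; apply: indep; rewrite /a; lra.
have [] := @continuous_FTC1_closed R f a x (x + 1) ltac:(lra)
  (continuous_integrable _ _ _ _ _ cf) ltac:(rewrite /a; lra) (cf x).
rewrite derive1E => d1 d2.
rewrite -[f x]subr0; apply: is_deriveB.
by rewrite -d2; apply/derivableP.
Qed.

(** With a primitive G of [g], the left side is G (x + L) - G (x - L). By periodicity this has zero
    derivative in x, so it equals its value at x = 0. *)
Lemma Rintegral_periodic_reflect g L x : 0 < L -> continuous g ->
  periodic g (2 * L) ->
  \int[mu]_(y in `]-L, L[) g (x - y) = \int[mu]_(y in `]-L, L[) g y.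
Proof.
move=> L0 cg pg; have [G dG] := primitive_exists _ cg.
have LL : - L <= L by lra.
have -> : \int[mu]_(y in `]-L, L[) g y = G L - G (- L).
  exact: Rintegral_derivative.
have -> : \int[mu]_(y in `]-L, L[) g (x - y) = - G (x - L) - - G (x - - L).
  apply: (Rintegral_derivative (fun y => - G (x - y))) => //.
    move=> y; apply: continuous_comp; last exact: cg.
    by apply: continuousB; [exact: cst_continuous|exact: cvg_id].
  move=> y; rewrite -[g _]opprK; apply: is_deriveN.
  by rewrite -[- g _]mulrN1; apply: (@is_derive1_comp _ G); exact: is_derive_reflect.
rewrite opprK addrC.
suff H (y : R) : is_derive y 1 (fun x : R => G (x - - L) - G (x - L)) 0.
  by have := is_derive_0_is_cst x 0 H; rewrite !sub0r opprK.
rewrite -(subrr (g (y - - L))).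
apply: is_deriveB.
  rewrite -[g _]mulr1; apply: (@is_derive1_comp _ G).
  exact: is_derive_shift.
have -> : g (y - - L) = g (y - L) by rewrite -(pg (y - L)); congr g; ring.
rewrite -[g _]mulr1; apply: (@is_derive1_comp _ G); exact: is_derive_shift.
Qed.

(** For A > 0 the weight [lam = B / A] gives the claim. For A = 0 the weight [lam = (C + 1) / B]
    contradicts B > 0. *)
Lemma sqr_le_mul_of_young (A B C : R) : 0 <= A -> 0 <= C ->
  (forall lam : R, 0 < lam -> 2 * B <= lam * A + lam^-1 * C) ->
  0 <= B -> B ^+ 2 <= A * C.
Proof.
move=> A0 C0 H B0.
have [->|Bn0] := eqVneq B 0; first by rewrite expr0n/= mulr_ge0.
have Bp : 0 < B by rewrite lt_neqAle eq_sym Bn0.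
have [A1|An0] := eqVneq A 0.
  have := H ((C + 1) / B) ltac:(apply: divr_gt0 => //; lra).
  rewrite A1 mulr0 add0r invf_div mulrAC ler_pdivlMr; last by lra.
  by move=> H1; have := mulr_ge0 B0 C0; lra.
have Ap : 0 < A by rewrite lt_neqAle eq_sym An0.
have := H (B / A) (divr_gt0 Bp Ap).
rewrite invf_div divfK//.
move=> H1; have H2 : B <= A / B * C by lra.
by move: H2; rewrite mulrAC ler_pdivlMr// expr2.
Qed.

(** Young's inequality with weight 1 dominates the product and makes it integrable. Integrating it
    with every weight [lam] and then optimising over [lam] bounds the integral of the absolute value
    of [f * g]. *)
Lemma Rintegral_cauchy_schwarz (D : set (measurableTypeR R)) f g : measurable D ->
  measurable_fun D f -> measurable_fun D g ->
  mu.-integrable D (EFin \o (fun x => f x ^+ 2)) ->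
  mu.-integrable D (EFin \o (fun x => g x ^+ 2)) ->
  mu.-integrable D (EFin \o (fun x => f x * g x)) /\
  (\int[mu]_(x in D) (f x * g x)) ^+ 2 <=
    (\int[mu]_(x in D) f x ^+ 2) * (\int[mu]_(x in D) g x ^+ 2).
Proof.
move=> mD mf mg If Ig.
have young lam x : 0 < lam ->
    2 * `|f x * g x| <= lam * f x ^+ 2 + lam^-1 * g x ^+ 2.
  move=> l0.
  have l1 : lam * lam^-1 = 1 by rewrite divff// gt_eqF.
  have l2 : 0 < lam^-1 by rewrite invr_gt0.
  have l3 z : lam * (f x + lam^-1 * z) ^+ 2 =
      lam * f x ^+ 2 + 2 * f x * z + lam^-1 * z ^+ 2.
    transitivity (lam * f x ^+ 2 + (lam * lam^-1) * 2 * f x * z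
      + (lam * lam^-1) * lam^-1 * z ^+ 2); first by ring.
    by rewrite l1; ring.
  have Hp : 0 <= lam * (f x + lam^-1 * g x) ^+ 2.
    by rewrite mulr_ge0 ?sqr_ge0// ltW.
  have Hm : 0 <= lam * (f x + lam^-1 * - g x) ^+ 2.
    by rewrite mulr_ge0 ?sqr_ge0// ltW.
  rewrite !l3 in Hp Hm.
  by case: (ger0P (f x * g x)) => _; lra.
have If' lam : mu.-integrable D (EFin \o (fun x => lam * f x ^+ 2)).
  exact: integrable_scale.
have Ig' lam : mu.-integrable D (EFin \o (fun x => lam * g x ^+ 2)).
  exact: integrable_scale.
have Is lam : mu.-integrable D
    (EFin \o (fun x => lam * f x ^+ 2 + lam^-1 * g x ^+ 2)).
  exact: (integrableD mD (If' lam) (Ig' lam^-1)).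
have Ifg : mu.-integrable D (EFin \o (fun x => f x * g x)).
  apply: (le_integrable mD _ _ (Is 1)).
    by apply/measurable_EFinP; exact: measurable_funM.
  move=> x Dx /=; rewrite lee_fin.
  apply: le_trans (ler_norm _).
  by have := young 1 x ltr01; have := normr_ge0 (f x * g x); lra.
have Ia : mu.-integrable D (EFin \o (fun x => `|f x * g x|)).
  exact: (integrable_norm Ifg).
split => //.
rewrite -real_normK ?num_real//.
apply: (@le_trans _ _ ((\int[mu]_(x in D) `|f x * g x|) ^+ 2)).
  by rewrite lerXn2r ?nnegrE//; [exact: Rintegral_ge0|exact: le_normr_Rintegral].
apply: sqr_le_mul_of_young.
- by apply: Rintegral_ge0 => x _; exact: sqr_ge0.
- by apply: Rintegral_ge0 => x _; exact: sqr_ge0.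
- move=> lam l0.
  rewrite -!RintegralZl// -RintegralD//.
  apply: le_Rintegral => //.
  + exact: integrable_scale.
  + by move=> x _; exact: young.
- by apply: Rintegral_ge0 => x _; exact: normr_ge0.
Qed.

End integration.

(** * Periodic functions of class C^1 and Agmon's inequality *)

Section continuous_integrands.
Context {R : realType}.
Notation mu := (@lebesgue_measure R).
Implicit Types (f g h e : R -> R) (a b c d x L : R).

Lemma RintegralD_continuous f g a b : continuous f -> continuous g ->
  \int[mu]_(x in `]a, b[) (f x + g x) =
  \int[mu]_(x in `]a, b[) f x + \int[mu]_(x in `]a, b[) g x.
Proof. by move=> cf cg; apply: RintegralD => //; exact: continuous_integrable. Qed.

Lemma RintegralB_continuous f g a b : continuous f -> continuous g ->
  \int[mu]_(x in `]a, b[) (f x - g x) =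
  \int[mu]_(x in `]a, b[) f x - \int[mu]_(x in `]a, b[) g x.
Proof. by move=> cf cg; apply: RintegralB => //; exact: continuous_integrable. Qed.

Lemma RintegralZ_continuous k f a b : continuous f ->
  \int[mu]_(x in `]a, b[) (k * f x) = k * \int[mu]_(x in `]a, b[) f x.
Proof. by move=> cf; apply: RintegralZl => //; exact: continuous_integrable. Qed.

Lemma le_Rintegral_continuous f g a b : continuous f -> continuous g ->
  (forall x, f x <= g x) ->
  \int[mu]_(x in `]a, b[) f x <= \int[mu]_(x in `]a, b[) g x.
Proof.
by move=> cf cg fg; apply: le_Rintegral => //; exact: continuous_integrable.
Qed.

Lemma Rintegral_subitv f a b c d : continuous f -> (forall x, 0 <= f x) ->
  a <= c -> c <= d -> d <= b ->
  \int[mu]_(x in `]c, d[) f x <= \int[mu]_(x in `]a, b[) f x.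
Proof.
move=> cf f0 ac cd db; have [F dF] := primitive_exists _ cf.
have I p q : p <= q -> \int[mu]_(x in `]p, q[) f x = F q - F p.
  by move=> pq; apply: Rintegral_derivative.
have pos p q : p <= q -> 0 <= F q - F p.
  by move=> pq; rewrite -I//; apply: Rintegral_ge0.
have := pos _ _ ac; have := pos _ _ db.
by rewrite !I//; [lra|exact: (le_trans ac (le_trans cd db))].
Qed.

Lemma Rintegral_cst_itv k a b : a <= b ->
  \int[mu]_(x in `]a, b[) k = k * (b - a).
Proof.
move=> ab; rewrite Rintegral_cst//; congr (k * _).
apply: (etrans (congr1 fine (lebesgue_measure_itv `]a, b[))) => /=.
rewrite lte_fin.
by move: ab; rewrite le_eqVlt => /predU1P[->|->]//=; rewrite ltxx subrr.
Qed.

Lemma is_derive_C1 f x : is_C1 f -> is_derive x 1 f (derive1 f x).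
Proof. by move=> [df _]; rewrite derive1E; apply/derivableP. Qed.

Lemma derivable_cont f : (forall x, derivable f x 1) -> continuous f.
Proof.
by move=> df x; apply: differentiable_continuous; apply/derivable1_diffP.
Qed.

Lemma C1_continuous f : is_C1 f -> continuous f.
Proof. by move=> [df _]; exact: derivable_cont. Qed.

Lemma is_C1_derive f f' : (forall x, is_derive x 1 f (f' x)) ->
  continuous f' -> is_C1 f /\ derive1 f = f'.
Proof.
move=> df cf'; have E : derive1 f = f'.
  by apply/funext => x; rewrite derive1E; exact: derive_val.
by split => //; split; [move=> x; exact: ex_derive|rewrite E].
Qed.

Lemma periodic_derive1 f T : is_C1 f -> periodic f T -> periodic (derive1 f) T.
Proof.
move=> C1f pf x; rewrite [in RHS](_ : f = f \o (fun y => y - (- T))); last first.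
  by apply/funext => y /=; rewrite opprK pf.
rewrite [RHS]derive1E; apply/esym.
have H : is_derive x 1 (f \o (fun y => y - (- T))) (derive1 f (x - - T) * 1).
  by apply: is_derive1_comp; [exact: is_derive_C1|exact: is_derive_shift].
by rewrite (@derive_val _ _ _ _ _ _ _ H) mulr1 opprK.
Qed.

Lemma continuous_reflect f x : continuous f -> continuous (fun y => f (x - y)).
Proof.
move=> cf y; apply: continuous_comp; last exact: cf.
by apply: continuousB; [exact: cst_continuous|exact: cvg_id].
Qed.

Lemma continuousMf f g : continuous f -> continuous g ->
  continuous (fun x => f x * g x).
Proof. by move=> cf cg x; apply: continuousM; [exact: cf|exact: cg]. Qed.

Lemma continuousDf f g : continuous f -> continuous g ->
  continuous (fun x => f x + g x).
Proof. by move=> cf cg x; apply: continuousD; [exact: cf|exact: cg]. Qed.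

Lemma continuousBf f g : continuous f -> continuous g ->
  continuous (fun x => f x - g x).
Proof. by move=> cf cg x; apply: continuousB; [exact: cf|exact: cg]. Qed.

Lemma continuousZf k f : continuous f -> continuous (fun x => k * f x).
Proof. by move=> cf; apply: continuousMf => //; exact: cst_continuous. Qed.

Lemma periodicM f g T : periodic f T -> periodic g T ->
  periodic (fun x => f x * g x) T.
Proof. by move=> pf pg x; rewrite pf pg. Qed.

Lemma ip_ge0 L f : 0 <= ip L f f.
Proof. by apply: Rintegral_ge0 => x _; rewrite -expr2 sqr_ge0. Qed.

Lemma ip_reflect L f x : 0 < L -> continuous f -> periodic f (2 * L) ->
  ip L (fun y => f (x - y)) (fun y => f (x - y)) = ip L f f.
Proof.
move=> L0 cf pf.
apply: (Rintegral_periodic_reflect (fun y => f y * f y) L x) => //.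
- exact: continuousMf.
- exact: periodicM.
Qed.

(* [E (0) ^ 2 - E (y) ^ 2] is the integral of [2 E E'] for the reflected
   function [E (y) = e (x - y)]; averaging over [y] gives the bound. *)
Lemma agmon L e eta x : 0 < L -> 0 < eta -> is_C1 e -> periodic e (2 * L) ->
  e x ^+ 2 <= eta * ip L (derive1 e) (derive1 e) +
              (eta^-1 + (2 * L)^-1) * ip L e e.
Proof.
move=> L0 eta0 C1e pe.
have ce := C1_continuous _ C1e; have ce' := C1e.2.
have pe' := periodic_derive1 _ _ C1e pe.
(* By Young's inequality [g] dominates [w], the derivative of E ^ 2; by periodicity its integral
   over a period does not depend on x. *)
pose g z := eta * (derive1 e (x - z) * derive1 e (x - z)) +
  eta^-1 * (e (x - z) * e (x - z)).
have crE := continuous_reflect _ x ce; have crE' := continuous_reflect _ x ce'.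
have cg : continuous g.
  by apply: continuousDf; apply: continuousZf; exact: continuousMf.
have i0 : 0 < eta^-1 by rewrite invr_gt0.
have g0 z : 0 <= g z.
  by rewrite addr_ge0// mulr_ge0 ?(ltW eta0) ?(ltW i0)// -expr2 sqr_ge0.
pose D := eta * ip L (derive1 e) (derive1 e) + eta^-1 * ip L e e.
have gD : \int[mu]_(z in `]-L, L[) g z = D.
  rewrite RintegralD_continuous; try by apply: continuousZf; exact: continuousMf.
  rewrite !RintegralZ_continuous; try exact: continuousMf.
  by rewrite /D -(ip_reflect L _ x L0 ce pe) -(ip_reflect L _ x L0 ce' pe').
pose w z := - (e (x - z) * derive1 e (x - z) + derive1 e (x - z) * e (x - z)).
have cw : continuous w.
  by move=> z; apply: cvgN; apply: (continuousDf _ _ _ _ z); exact: continuousMf.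
have wg z : `|w z| <= g z.
  have l1 : eta * eta^-1 = 1 by rewrite divff// gt_eqF.
  have l3 p q : eta * (p + eta^-1 * q) ^+ 2 =
      eta * (p * p) + 2 * p * q + eta^-1 * (q * q).
    transitivity (eta * (p * p) + (eta * eta^-1) * 2 * p * q
      + (eta * eta^-1) * eta^-1 * (q * q)); first by ring.
    by rewrite l1; ring.
  have P p q : 0 <= eta * (p + eta^-1 * q) ^+ 2.
    by rewrite mulr_ge0 ?sqr_ge0// ltW.
  have P1 := P (derive1 e (x - z)) (e (x - z)).
  have P2 := P (derive1 e (x - z)) (- e (x - z)).
  rewrite !l3 in P1 P2.
  by rewrite ler_norml /w /g; apply/andP; split; lra.
have dE2 (z : R) : is_derive z 1 (fun z : R => e (x - z) * e (x - z)) (w z).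
  have H : is_derive z 1 (fun z : R => e (x - z)) (derive1 e (x - z) * -1).
    by apply: (@is_derive1_comp _ e); [exact: is_derive_C1|exact: is_derive_reflect].
  have -> : w z = e (x - z) *: (derive1 e (x - z) * -1) +
                  e (x - z) *: (derive1 e (x - z) * -1).
    by rewrite /w /GRing.scale/=; ring.
  exact: is_deriveM.
(* E ^ 2 changes by at most [D] between any two points of [-L, L], since [g] is nonnegative and has
   integral [D] over the whole period. *)
have step a b : - L <= a -> a <= b -> b <= L ->
    `|e (x - b) * e (x - b) - e (x - a) * e (x - a)| <= D.
  move=> La ab bL; rewrite -gD.
  apply: le_trans (Rintegral_subitv g _ _ _ _ cg g0 La ab bL).
  rewrite -(Rintegral_derivative (fun z => e (x - z) * e (x - z)) w)//.
  apply: le_trans (le_normr_Rintegral _ _) _ => //.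
    exact: continuous_integrable.
  apply: le_Rintegral => //; last exact: continuous_integrable.
  by apply: integrable_norm; exact: continuous_integrable.
have pt y : `]-L, L[%classic y -> e x ^+ 2 <= e (x - y) * e (x - y) + D.
  rewrite /= in_itv/= => /andP[/ltW y1 /ltW y2].
  have [y0|/ltW y0] := leP y 0.
    have := step y 0 y1 y0 (ltW L0).
    by rewrite subr0 ler_norml expr2 => /andP[_]; lra.
  have := step 0 y ltac:(lra) y0 y2.
  by rewrite subr0 ler_norml expr2 => /andP[+ _]; lra.
have LL : - L <= L by lra.
have : \int[mu]_(y in `]-L, L[) (e x ^+ 2) <=
       \int[mu]_(y in `]-L, L[) (e (x - y) * e (x - y) + D).
  apply: le_Rintegral => //; apply: continuous_integrable.
    exact: cst_continuous.
  by apply: continuousDf; [exact: continuousMf|exact: cst_continuous].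
rewrite RintegralD_continuous; [|exact: continuousMf|exact: cst_continuous].
rewrite !Rintegral_cst_itv//.
rewrite -[X in _ <= X + _]/(ip L (fun y => e (x - y)) (fun y => e (x - y))).
rewrite ip_reflect// /D.
move: (ip L _ _) (ip L _ _) => p q H.
have L20 : 0 < 2 * L by lra.
rewrite -(ler_pM2r L20).
have -> : (eta * p + (eta^-1 + (2 * L)^-1) * q) * (2 * L) =
    2 * L * (2 * L)^-1 * q + (eta * p + eta^-1 * q) * (2 * L) by ring.
rewrite divff ?gt_eqF// mul1r; apply: le_trans (le_trans _ H) _; rewrite le_eqVlt.
  by apply/orP; left; apply/eqP; ring.
by apply/orP; left; apply/eqP; ring.
Qed.

End continuous_integrands.

(** * The nonlocal operator *)

Section nonlocal_operator.
Context {R : realType}.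
Notation mu := (@lebesgue_measure R).
Implicit Types (a x L eta : R) (phi : R -> R).

Definition Jkernel (xi : R) : R := `|xi| `^ (- 3^-1).

Lemma measurable_Jkernel (D : set (measurableTypeR R)) : measurable_fun D Jkernel.
Proof.
apply: (@measurable_funS _ _ (measurableTypeR R) _ setT) => //.
exact: (measurableT_comp (measurable_powR (- 3^-1)) (@normr_measurable R setT)).
Qed.

(** For positive x the squared kernel is x ^ (-2/3), with primitive 3 x ^ (1/3). Dropping the value
    of the primitive at [b] leaves a bound uniform in [b]. *)
Lemma Jkernel_sqr_integral_away a b : 0 < b -> b <= a ->
  (\int[mu]_(x in `[b, a]) (Jkernel x ^+ 2)%:E <= (3 * a `^ 3^-1)%:E)%E.
Proof.
move=> b0 ba.
have a3 : 0 <= 3 * a `^ 3^-1 by rewrite mulr_ge0// powR_ge0.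
move: ba; rewrite le_eqVlt => /predU1P[->|ba].
  by rewrite set_itv1 integral_set1 lee_fin.
pose F (x : R) : R := 3 * x `^ 3^-1.
pose f (x : R) : R := x `^ (3^-1 - 1).
have dF (x : R) : 0 < x -> is_derive x 1 F (f x).
  move=> x0; have xin : x \in `]0, +oo[ by rewrite in_itv/= x0.
  have d := @derivable_powR R 1 3^-1 x xin.
  have v := @powR_derive1 R 3^-1 x xin.
  have H : is_derive x 1 (fun y : R => y `^ 3^-1) (3^-1 * f x).
    by rewrite /f -v derive1E; apply/derivableP.
  have -> : f x = 3 *: (3^-1 * f x) by rewrite /GRing.scale/= mulVKf.
  exact: is_deriveZ.
have df (x : R) : 0 < x -> derivable f x 1.
  by move=> x0; apply: derivable_powR; rewrite in_itv/= x0.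
have -> : (\int[mu]_(x in `[b, a]) (Jkernel x ^+ 2)%:E =
           \int[mu]_(x in `[b, a]) (f x)%:E)%E.
  apply: eq_integral => x; rewrite inE/= in_itv/= => /andP[bx _].
  have x0 := lt_le_trans b0 bx.
  rewrite /Jkernel /f gtr0_norm// expr2 -powRD; last first.
    by apply/implyP => _; rewrite gt_eqF.
  by congr ((_ `^ _)%:E); field.
have cF (x : R) : 0 < x -> {for x, continuous F}.
  move=> x0; apply: differentiable_continuous; apply/derivable1_diffP.
  by have := dF x x0 => -[].
rewrite (@continuous_FTC2 _ f F)//.
- by rewrite -EFinB lee_fin /F lerBlDr lerDl mulr_ge0// powR_ge0.
- apply: derivable_within_continuous => x; rewrite in_itv/= => /andP[bx _].
  exact/df/(lt_le_trans b0).
- split.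
  + move=> x; rewrite in_itv/= => /andP[bx _].
    by have := dF x (lt_trans b0 bx) => -[].
  + exact/cvg_at_right_filter/cF.
  + exact/cvg_at_left_filter/cF/(lt_trans b0).
- move=> x; rewrite in_itv/= => /andP[bx _]; rewrite derive1E.
  by have H := dF x (lt_trans b0 bx); exact: derive_val.
Qed.

(** Monotone convergence along the intervals [a / (n + 1), a], which exhaust ]0, a], carries the
    uniform bound up to the singularity. *)
Lemma Jkernel_sqr_integral a : 0 < a ->
  (\int[mu]_(x in `]0%R, a]) (Jkernel x ^+ 2)%:E <= (3 * a `^ 3^-1)%:E)%E.
Proof.
move=> a0; pose F (n : nat) : set (measurableTypeR R) := `[a / n.+1%:R, a]%classic.
have FU : (`]0%R, a]%classic : set (measurableTypeR R)) = \bigcup_n F n.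
  apply/seteqP; split=> [x|x [n _]]; rewrite /F /= !in_itv/=.
    move=> /andP[x0 xa]; exists (Num.truncn (a / x)) => //=.
    rewrite /F /= in_itv/= xa andbT ler_pdivrMr// mulrC -ler_pdivrMr//.
    exact/ltW/truncnS_gt.
  by move=> /andP[x0 ->]; rewrite andbT (lt_le_trans _ x0)// divr_gt0.
have mk : measurable_fun [set: measurableTypeR R]
    (fun x => (Jkernel x ^+ 2)%:E).
  apply/measurable_EFinP; apply: measurable_funX; exact: measurable_Jkernel.
have /= := @ge0_nondecreasing_set_cvg_integral _ _ R F
  (fun x => (Jkernel x ^+ 2)%:E) mu _ _ _ _.
rewrite -FU => H.
apply: (cvge_le _ (H _ _ _ _)).
- apply: nearW => n; apply: Jkernel_sqr_integral_away; first exact: divr_gt0.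
  by rewrite ler_pdivrMr// ler_peMr ?ler1n// ltW.
- move=> n m nm; apply/subsetPset => x; rewrite /F /= !in_itv/= => /andP[+ ->].
  rewrite andbT; apply: le_trans; rewrite ler_pM2l// lef_pV2 ?posrE//.
  by rewrite ler_nat.
- by move=> n; exact: measurable_itv.
- by move=> n; apply: measurable_funS mk.
- by move=> n x _; rewrite lee_fin sqr_ge0.
Qed.

End nonlocal_operator.

(** * The nonlocal integral near its singularity and away from it *)

Section nonlocal_operator_bound.
Context {R : realType}.
Notation mu := (@lebesgue_measure R).
Implicit Types (a x L eta : R) (phi : R -> R).

Lemma Jkernel_sqr_integrable a : 0 < a ->
  mu.-integrable `]0, a] (EFin \o (fun x => Jkernel x ^+ 2)).
Proof.
move=> a0; apply/integrableP; split.
  by apply/measurable_EFinP; apply: measurable_funX; exact: measurable_Jkernel.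
apply: le_lt_trans (ltry (3 * a `^ 3^-1)).
apply: le_trans (Jkernel_sqr_integral a a0).
by rewrite le_eqVlt; apply/orP; left; apply/eqP; apply: eq_integral => x _ /=;
  rewrite ger0_norm// sqr_ge0.
Qed.

Lemma Jkernel_sqr_Rintegral a : 0 < a ->
  \int[mu]_(x in `]0, a]) Jkernel x ^+ 2 <= 3 * a `^ 3^-1.
Proof.
move=> a0; rewrite -lee_fin; apply: le_trans (Jkernel_sqr_integral a a0).
by rewrite /Rintegral fineK//; apply: integrable_fin_num => //;
  exact: Jkernel_sqr_integrable.
Qed.

Lemma continuous_measurable_itv (i : interval R) (f : R -> R) : continuous f ->
  measurable_fun ([set` i] : set (measurableTypeR R)) f.
Proof.
move=> cf; apply: (@measurable_funS _ _ (measurableTypeR R) _ setT) => //.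
exact: continuous_measurable_fun.
Qed.

(** By Cauchy-Schwarz the kernel contributes 3 a ^ (1/3), which tends to 0 with [a]. The squared
    derivative over ]0, a] is bounded by its integral over a period, which the reflection about x
    leaves unchanged. *)
Lemma Jop_near_bound L a phi x : 0 < L -> 0 < a -> a <= L -> is_C1 phi ->
  periodic phi (2 * L) ->
  mu.-integrable `]0, a] (EFin \o (fun xi => Jkernel xi * derive1 phi (x - xi))) /\
  (\int[mu]_(xi in `]0, a]) (Jkernel xi * derive1 phi (x - xi))) ^+ 2 <=
    3 * a `^ 3^-1 * ip L (derive1 phi) (derive1 phi).
Proof.
move=> L0 a0 aL C1 per.
have crd := continuous_reflect _ x C1.2.
have cc : continuous (fun y => derive1 phi (x - y) ^+ 2).
  by under eq_fun do rewrite expr2; exact: continuousMf.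
have [I le] := Rintegral_cauchy_schwarz (`]0, a]%classic) Jkernel
  (fun xi => derive1 phi (x - xi)) (measurable_itv _) (measurable_Jkernel _)
  (continuous_measurable_itv _ _ crd) (Jkernel_sqr_integrable a a0)
  (continuous_integrable _ _ _ _ _ cc).
split; first exact: I.
apply: (le_trans le); apply: ler_pM.
- by apply: Rintegral_ge0 => y _; exact: sqr_ge0.
- by apply: Rintegral_ge0 => y _; exact: sqr_ge0.
- exact: Jkernel_sqr_Rintegral.
- rewrite -Rintegral_itv_bndo_bndc; last exact: continuous_integrable.
  rewrite -(ip_reflect L _ x L0 C1.2 (periodic_derive1 _ _ C1 per)).
  rewrite /ip; under [leRHS]eq_Rintegral do rewrite -expr2.
  apply: (Rintegral_subitv _ _ _ _ _ cc (fun y => sqr_ge0 _)) => //; last exact: ltW.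
  by rewrite oppr_le0 ltW.
Qed.

(** Off the singularity the kernel is smooth: integration by parts moves the derivative from [phi]
    to the kernel, and only a sup bound on [phi] is left. The constant collects two boundary values
    and the derivative of the kernel. *)
Lemma Jop_far_bound L a : 0 < a -> a < L ->
  exists2 C, 0 <= C & forall phi x B, is_C1 phi -> (forall y, `|phi y| <= B) ->
  `|\int[mu]_(xi in `]a, L[) (Jkernel xi * derive1 phi (x - xi))| <= C * B.
Proof.
move=> a0 aL.
(* [f] is the derivative of the kernel [k]. Its absolute value decreases, so its value [m] at [a]
   bounds it on [a, L]. *)
pose f (y : R) : R := - 3^-1 * y `^ (- 3^-1 - 1).
pose k (y : R) : R := y `^ (- 3^-1).
pose m := 3^-1 * a `^ (- 3^-1 - 1).
have m0 : 0 <= m by rewrite mulr_ge0// powR_ge0.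
exists (Jkernel L + Jkernel a + m * (L - a)).
  by rewrite !addr_ge0 ?powR_ge0// mulr_ge0// subr_ge0 ltW.
move=> phi x B C1 phiB.
have B0 : 0 <= B by apply: le_trans (phiB 0).
have dF (y : R) : 0 < y -> derivable k y 1.
  by move=> y0; apply: derivable_powR; rewrite in_itv/= y0.
have dp (y : R) p : 0 < y -> {for y, continuous (fun z : R => z `^ p)}.
  move=> y0; apply: differentiable_continuous; apply/derivable1_diffP.
  by apply: derivable_powR; rewrite in_itv/= y0.
have cfp : {within `[a, L], continuous f}.
  apply: derivable_within_continuous => y; rewrite in_itv/= => /andP[ay _].
  apply: derivableM => //; apply: derivable_powR.
  by rewrite in_itv/= (lt_le_trans a0 ay).
pose G (y : R) : R := - phi (x - y).
have dG (y : R) : is_derive y 1 G (derive1 phi (x - y)).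
  rewrite -[X in is_derive _ _ _ X]opprK; apply: is_deriveN.
  rewrite -[X in is_derive _ _ _ X]mulrN1; apply: (@is_derive1_comp _ phi).
    exact: is_derive_C1.
  exact: is_derive_reflect.
have crd := continuous_reflect _ x C1.2.
have [C1G dGE] := is_C1_derive G _ dG crd.
have cG := C1_continuous _ C1G.
have L0 := lt_trans a0 aL.
have GB y : `|G y| <= B by rewrite normrN.
have IfG : mu.-integrable `[a, L] (EFin \o (fun y => f y * G y)).
  apply: continuous_compact_integrable; first exact: segment_compact.
  by move=> y; apply: continuousM; [exact: cfp|exact: continuous_subspaceT].
have IFg : mu.-integrable `[a, L]
    (EFin \o (fun y => Jkernel y * derive1 phi (x - y))).
  apply: (@eq_integrable _ (measurableTypeR R) _ mu _ (measurable_itv `[a, L])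
    (EFin \o (fun y => k y * derive1 phi (x - y)))).
  - move=> y; rewrite inE/= in_itv/= => /andP[ay _].
    by rewrite /Jkernel gtr0_norm// (lt_le_trans a0).
  - apply: continuous_compact_integrable; first exact: segment_compact.
    move=> y; apply: continuousM; last exact: continuous_subspaceT.
    apply: derivable_within_continuous => z.
    by rewrite in_itv/= => /andP[az _]; apply: dF; exact: lt_le_trans az.
have IBP : \int[mu]_(y in `[a, L]) (k y * derive1 phi (x - y)) =
    (k L * G L - k a * G a) - \int[mu]_(y in `[a, L]) (f y * G y).
  apply: (@Rintegration_by_parts R k G f (fun y => derive1 phi (x - y)) a L aL cfp).
  - split; [|exact/cvg_at_right_filter/dp|exact/cvg_at_left_filter/dp].
    by move=> y; rewrite in_itv/= => /andP[ay _]; apply: dF; exact: lt_trans ay.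
  - by move=> y; rewrite in_itv/= => /andP[ay _]; apply: powR_derive1;
      rewrite in_itv/= (lt_trans a0 ay).
  - exact: continuous_subspaceT.
  - split; [by move=> y _; exact: C1G.1| |].
    + exact/cvg_at_right_filter/cG.
    + exact/cvg_at_left_filter/cG.
  - by move=> y _; rewrite dGE.
have -> : \int[mu]_(xi in `]a, L[) (Jkernel xi * derive1 phi (x - xi)) =
    (k L * G L - k a * G a) - \int[mu]_(y in `[a, L]) (f y * G y).
  rewrite -IBP.
  rewrite Rintegral_itv_bndo_bndc; last first.
    apply: (@integrableS _ _ R mu `[a, L] _ _ _ _ _ IFg); try exact: measurable_itv.
    by apply: subset_itvScc; rewrite ?bnd_simp.
  rewrite Rintegral_itv_obnd_cbnd; last first.
    apply: (@integrableS _ _ R mu `[a, L] _ _ _ _ _ IFg); try exact: measurable_itv.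
    by apply: subset_itvScc; rewrite ?bnd_simp.
  apply: eq_Rintegral => y; rewrite inE/= in_itv/= => /andP[ay _].
  by rewrite /Jkernel gtr0_norm// (lt_le_trans a0).
have H1 : `|k L * G L| <= Jkernel L * B.
  by rewrite normrM /Jkernel (gtr0_norm L0) ger0_norm ?powR_ge0// ler_wpM2l ?powR_ge0.
have H2 : `|k a * G a| <= Jkernel a * B.
  by rewrite normrM /Jkernel (gtr0_norm a0) ger0_norm ?powR_ge0// ler_wpM2l ?powR_ge0.
have H3 : `|\int[mu]_(y in `[a, L]) (f y * G y)| <= m * (L - a) * B.
  apply: (le_trans (le_normr_Rintegral _ IfG)) => //.
  have -> : m * (L - a) * B = \int[mu]_(y in `]a, L[) (m * B).
    by rewrite Rintegral_cst_itv ?ltW//; ring.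
  rewrite Rintegral_itv_bndo_bndc; last by apply: continuous_integrable; exact: cst_continuous.
  rewrite Rintegral_itv_obnd_cbnd; last by apply: continuous_integrable; exact: cst_continuous.
  apply: le_Rintegral => //.
  - exact: integrable_norm IfG.
  - by apply: continuous_integrable; exact: cst_continuous.
  - move=> y; rewrite /= in_itv/= => /andP[ay _].
    rewrite normrM; apply: ler_pM => //.
    rewrite /f /m normrM normrN !ger0_norm ?powR_ge0// ler_pM2l//.
    have -> : - 3^-1 - 1 = - (3^-1 + 1) :> R by ring.
    have y0 := lt_le_trans a0 ay.
    rewrite !powRN lef_pV2 ?posrE ?powR_gt0//.
    by apply: ge0_ler_powR => //; rewrite nnegrE ltW.
apply: le_trans (ler_normB _ _) _; rewrite mulrDl lerD//.
by apply: le_trans (ler_normB _ _) _; rewrite mulrDl lerD.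
Qed.

End nonlocal_operator_bound.

(** * Bounds, continuity and linearity of J *)

Section Jop_properties.
Context {R : realType}.
Notation mu := (@lebesgue_measure R).
Implicit Types (a x L eta : R) (phi : R -> R).

Lemma Jop_integrable L phi x : 0 < L -> is_C1 phi -> periodic phi (2 * L) ->
  mu.-integrable `]0, L[ (EFin \o (fun xi => Jkernel xi * derive1 phi (x - xi))).
Proof.
move=> L0 C1 per; have [I _] := Jop_near_bound L L phi x L0 L0 (lexx L) C1 per.
apply: (@integrableS _ _ R mu `]0, L] _ _ _ _ _ I); try exact: measurable_itv.
by move=> z; rewrite /= !in_itv/= => /andP[-> /ltW].
Qed.

(** The order of choices matters: [a] is fixed first to make the near part small, which determines
    the far constant [K]; only then is the parameter of Agmon's inequality taken small relative to
    [K]. *)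
Lemma Jop_bound L eta : 0 < L -> 0 < eta ->
  exists2 C, 0 <= C & forall phi x, is_C1 phi -> periodic phi (2 * L) ->
    Jop L phi x ^+ 2 <= eta * ip L (derive1 phi) (derive1 phi) + C * ip L phi phi.
Proof.
move=> L0 eta0.
(* With a ^ (1/3) <= b the near factor 3 a ^ (1/3) is at most eta / 4. *)
pose b := eta / 12.
have b0 : 0 < b by rewrite divr_gt0.
pose a := Num.min (b ^+ 3) (L / 2).
have a0 : 0 < a by rewrite lt_min exprn_gt0//= divr_gt0.
have aL : a < L by rewrite gt_min; apply/orP; right; lra.
have ab : a `^ 3^-1 <= b.
  have -> : b = (b ^+ 3) `^ 3^-1.
    by rewrite -powR_mulrn ?ltW// -powRrM mulfV// powRr1// ltW.
  apply: ge0_ler_powR; rewrite ?nnegrE ?exprn_ge0 ?(ltW a0) ?(ltW b0)//.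
  by rewrite ge_min lexx.
have [K K0 HK] := Jop_far_bound L a a0 aL.
(* Chosen so that K ^ 2 * eta2 <= eta / 4. The two quarters, doubled by (A + B) ^ 2 <= 2 A ^ 2 + 2 B
   ^ 2, add up to [eta]. *)
pose eta2 := eta / (4 * (K ^+ 2 + 1)).
have K1 : 0 < K ^+ 2 + 1 by rewrite ltr_wpDl// sqr_ge0.
have eta20 : 0 < eta2 by rewrite divr_gt0// mulr_gt0.
pose C := eta2^-1 + (2 * L)^-1.
have C0 : 0 <= C by rewrite addr_ge0// invr_ge0 ?ltW// mulr_gt0.
exists (2 * K ^+ 2 * C); first by rewrite mulr_ge0// mulr_ge0// sqr_ge0.
move=> phi x C1 per.
set p := ip L (derive1 phi) _; set q := ip L phi phi.
have p0 : 0 <= p := ip_ge0 _ _.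
have q0 : 0 <= q := ip_ge0 _ _.
pose M := eta2 * p + C * q.
have M0 : 0 <= M by rewrite addr_ge0// mulr_ge0// ltW.
have phiM y : `|phi y| <= Num.sqrt M.
  by rewrite -sqrtr_sqr ler_wsqrtr//; exact: agmon.
have farb := HK phi x (Num.sqrt M) C1 phiM.
have [_ nearb] := Jop_near_bound L a phi x L0 a0 (ltW aL) C1 per.
have split_J : Jop L phi x =
    \int[mu]_(xi in `]0, a]) (Jkernel xi * derive1 phi (x - xi)) +
    \int[mu]_(xi in `]a, L[) (Jkernel xi * derive1 phi (x - xi)).
  have := @Rintegral_itvB R (fun xi => Jkernel xi * derive1 phi (x - xi))
    (BRight 0) (BLeft L) a (Jop_integrable L phi x L0 C1 per).
  rewrite !bnd_simp => /(_ (ltW a0) aL) <-.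
  by rewrite /Jop addrC subrK.
rewrite split_J.
move: nearb farb; set A := Rintegral _ _ _; set B := Rintegral _ _ _.
rewrite -[ip _ _ _]/p => nearb farb.
have B2 : B ^+ 2 <= K ^+ 2 * M.
  rewrite -(sqr_sqrtr M0) -exprMn -real_normK ?num_real//.
  by rewrite lerXn2r ?nnegrE// mulr_ge0// sqrtr_ge0.
have A2 : A ^+ 2 <= eta / 4 * p.
  apply: (le_trans nearb); apply: ler_wpM2r => //.
  by move: ab; rewrite /b; lra.
have sq : (A + B) ^+ 2 <= 2 * A ^+ 2 + 2 * B ^+ 2.
  by rewrite -subr_ge0 (_ : _ - _ = (A - B) ^+ 2) ?sqr_ge0//; ring.
have E2 : K ^+ 2 * eta2 <= eta / 4.
  rewrite /eta2 mulrA ler_pdivrMr ?mulr_gt0//.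
  by have := ltW eta0; nra.
have E3 : K ^+ 2 * eta2 * p <= eta / 4 * p by apply: ler_wpM2r.
have E4 : K ^+ 2 * M = K ^+ 2 * eta2 * p + K ^+ 2 * C * q by rewrite /M; ring.
lra.
Qed.

(** Continuity under the integral sign, with a multiple of the kernel as dominating function. It
    makes the integrands containing J continuous, so that the calculus above applies to them. *)
Lemma Jop_continuous L phi : 0 < L -> is_C1 phi -> periodic phi (2 * L) ->
  continuous (Jop L phi).
Proof.
move=> L0 C1 per x.
have c1 (k : R) : continuous (fun _ : R => k) by exact: cst_continuous.
(* Cauchy-Schwarz against the constant 1 gives integrability of the kernel itself. *)
have [Ik _] := Rintegral_cauchy_schwarz (`]0, L]%classic) Jkernel (fun=> 1)
  (measurable_itv _) (measurable_Jkernel _)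
  (continuous_measurable_itv _ _ (c1 1))
  (Jkernel_sqr_integrable L L0)
  (continuous_integrable _ _ _ _ _ (c1 (1 ^+ 2))).
(* The interval contains y - xi for all y within 1 of x and all xi in ]0, L[. *)
have [c _ cmax] : exists2 c, c \in `[x - 1 - L, x + 1] &
    forall t, t \in `[x - 1 - L, x + 1] -> `|derive1 phi t| <= `|derive1 phi c|.
  apply: (@EVT_max R (fun t => `|derive1 phi t|)); first by lra.
  apply: continuous_subspaceT => t.
  by apply: continuous_comp; [exact: C1.2|exact: norm_continuous].
apply: (@continuity_under_integral R _ _ mu
  (fun x xi => Jkernel xi * derive1 phi (x - xi)) (`]0, L[%classic)
  (measurable_itv _) (x - 1) (x + 1) _ _
  (fun xi => `|derive1 phi c| * (Jkernel xi * 1)) _ _ x).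
- by move=> y _; exact: Jop_integrable.
- apply: aeW => xi _ y _.
  apply: (continuousZf (Jkernel xi) (fun l => derive1 phi (l - xi)) _ y) => z.
  apply: (@continuous_comp _ _ _ (fun y => y - xi)); last exact: C1.2.
  by apply: continuousB; [exact: cvg_id|exact: cst_continuous].
- apply: integrable_scale; first exact: measurable_itv.
  apply: (@integrableS _ _ R mu `]0, L] _ _ _ _ _ Ik); try exact: measurable_itv.
  by move=> z; rewrite /= !in_itv/= => /andP[-> /ltW].
- move=> y; rewrite /= in_itv/= => /andP[y1 y2]; apply: aeW => xi.
  rewrite /= in_itv/= => /andP[xi0 xiL].
  have k0 : 0 <= Jkernel xi by exact: powR_ge0.
  rewrite mulr1 normrM mulrC (ger0_norm k0) ler_wpM2r//.
  by apply: cmax; rewrite in_itv/=; apply/andP; split; lra.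
- by rewrite inE/= in_itv/=; apply/andP; split; lra.
Qed.

Lemma C1_sub (f g : R -> R) : is_C1 f -> is_C1 g ->
  is_C1 (fun y => f y - g y) /\
  derive1 (fun y => f y - g y) = fun y => derive1 f y - derive1 g y.
Proof.
move=> Cf Cg; apply: is_C1_derive; last by apply: continuousBf; [exact: Cf.2|exact: Cg.2].
by move=> y; apply: is_deriveB; exact: is_derive_C1.
Qed.

Lemma C1_mul (f g : R -> R) : is_C1 f -> is_C1 g ->
  is_C1 (fun y => f y * g y) /\
  derive1 (fun y => f y * g y) = fun y => derive1 f y * g y + f y * derive1 g y.
Proof.
move=> Cf Cg; apply: is_C1_derive; last first.
  by apply: continuousDf; apply: continuousMf;
    by [exact: Cf.2|exact: Cg.2|exact: C1_continuous].
move=> y; rewrite [X in is_derive _ _ _ X](_ : _ =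
  f y *: derive1 g y + g y *: derive1 f y); last by rewrite /GRing.scale/=; ring.
by apply: is_deriveM; exact: is_derive_C1.
Qed.

Lemma Rintegral_periodic_derivative L f : 0 < L -> is_C1 f ->
  periodic f (2 * L) -> \int[mu]_(x in `]-L, L[) derive1 f x = 0.
Proof.
move=> L0 C1f pf.
have -> : \int[mu]_(x in `]-L, L[) derive1 f x = f L - f (- L).
  apply: Rintegral_derivative; [lra|exact: C1f.2|].
  by move=> x; exact: is_derive_C1.
by rewrite -(pf (- L)) (_ : - L + 2 * L = L) ?subrr//; ring.
Qed.

Lemma Jop_diff L phi psi x : 0 < L -> is_C1 phi -> periodic phi (2 * L) ->
  is_C1 psi -> periodic psi (2 * L) ->
  Jop L (fun y => phi y - psi y) x = Jop L phi x - Jop L psi x.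
Proof.
move=> L0 C1 p1 C2 p2; rewrite /Jop -RintegralB//; try exact: Jop_integrable.
apply: eq_Rintegral => y _.
rewrite (C1_sub phi psi C1 C2).2.
by rewrite /Jkernel; ring.
Qed.

(** Pointwise, Young's inequality bounds J phi' by J ^ 2 + phi' ^ 2 / 4. The last term costs a
    quarter of (phi', phi'); the sup bound on J, integrated over length 2 L with parameter 1 / (8
    L), costs another quarter. Half of the dissipation stays free for the quadratic term. *)
Lemma Jop_form_bound L : 0 < L ->
  exists2 K, 0 <= K & forall phi, is_C1 phi -> periodic phi (2 * L) ->
    `|ip L (Jop L phi) (derive1 phi)| <=
      2^-1 * ip L (derive1 phi) (derive1 phi) + K * ip L phi phi.
Proof.
move=> L0.
have [C C0 HC] := Jop_bound L (8 * L)^-1 L0 ltac:(by rewrite invr_gt0 mulr_gt0).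
exists (2 * L * C); first by rewrite !mulr_ge0// ltW.
move=> phi C1 per.
have cJ := Jop_continuous L phi L0 C1 per.
have cd := C1.2.
set p := ip L (derive1 phi) _; set q := ip L phi phi.
pose M := (8 * L)^-1 * p + C * q.
have cprod : continuous (fun y => Jop L phi y * derive1 phi y) by exact: continuousMf.
have cs : continuous (fun y => M + 4^-1 * (derive1 phi y * derive1 phi y)).
  apply: continuousDf; first exact: cst_continuous.
  by apply: continuousZf; exact: continuousMf.
apply: (le_trans (le_normr_Rintegral _ _)) => //.
  exact: continuous_integrable.
have H : \int[mu]_(y in `]-L, L[) `|Jop L phi y * derive1 phi y| <=
    \int[mu]_(y in `]-L, L[) (M + 4^-1 * (derive1 phi y * derive1 phi y)).
  apply: le_Rintegral_continuous => // y.
    by apply: (@continuous_comp _ _ _ (fun y => Jop L phi y * derive1 phi y));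
      [exact: cprod|exact: norm_continuous].
  apply: (@le_trans _ _ (Jop L phi y ^+ 2 + 4^-1 * (derive1 phi y * derive1 phi y))).
    have P := sqr_ge0 (Jop L phi y - 2^-1 * derive1 phi y).
    have N := sqr_ge0 (Jop L phi y + 2^-1 * derive1 phi y).
    by rewrite ler_norml; apply/andP; split; nra.
  by rewrite lerD2r; exact: HC.
apply: (le_trans H).
rewrite RintegralD_continuous; [|exact: cst_continuous|].
  rewrite RintegralZ_continuous; last exact: continuousMf.
  rewrite Rintegral_cst_itv; last by lra.
  rewrite -[Rintegral _ _ _]/p.
  rewrite (_ : M * (L - - L) = 4^-1 * p + 2 * L * C * q); first by lra.
  by rewrite /M; field; rewrite gt_eqF.
by apply: continuousZf; exact: continuousMf.
Qed.

End Jop_properties.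

(** * The scheme *)

Section scheme.
Context {R : realType}.
Notation mu := (@lebesgue_measure R).
Implicit Types (L M T dt eta : R) (X Y Z W V : R -> R).

(** The left side of one step of the scheme from [X] to [Y]. [W] stands for their midpoint and is a
    separate argument so as to match [half_step] directly. *)
Definition step_form L dt X Y W (chi : R -> R) : R :=
  ip L (fun x => (Y x - X x) / dt) chi + ip L (fun x => W x * derive1 W x) chi +
  ip L (derive1 W) (derive1 chi) - ip L (Jop L W) (derive1 chi).

Lemma ip_mean_le L X Y : continuous X -> continuous Y ->
  ip L (fun x => (X x + Y x) / 2) (fun x => (X x + Y x) / 2) <=
    2^-1 * (ip L X X + ip L Y Y).
Proof.
move=> cX cY; have cXX := continuousMf X X cX cX; have cYY := continuousMf Y Y cY cY.
have cXY : continuous (fun x => (X x + Y x) / 2).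
  by apply: continuousMf; [exact: continuousDf|exact: cst_continuous].
rewrite /ip -RintegralD_continuous// -RintegralZ_continuous; last exact: continuousDf.
apply: le_Rintegral_continuous.
- exact: continuousMf.
- by apply: continuousZf; exact: continuousDf.
- by move=> x; have := sqr_ge0 (X x - Y x); lra.
Qed.

(** The integrand is a third of the derivative of W ^ 3, which integrates to 0 over a period. *)
Lemma ip_transport_self L W : 0 < L -> is_C1 W -> periodic W (2 * L) ->
  ip L (fun x => W x * derive1 W x) W = 0.
Proof.
move=> L0 C1 per; have [C2 D2] := C1_mul W W C1 C1.
have [C3 D3] := C1_mul _ W C2 C1.
have := Rintegral_periodic_derivative L _ L0 C3
  (periodicM _ _ _ (periodicM _ _ _ per per) per).
rewrite D3 D2.
have cW := C1_continuous _ C1; have cW' := C1.2.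
rewrite (_ : Rintegral _ _ _ =
    \int[mu]_(x in `]-L, L[) (3 * (W x * derive1 W x * W x))); last first.
  by apply: eq_Rintegral => x _; ring.
rewrite RintegralZ_continuous; last first.
  by apply: continuousMf => //; exact: continuousMf.
by move/eqP; rewrite mulf_eq0 pnatr_eq0/= => /eqP.
Qed.

(** Energy estimate: against the midpoint, the time difference yields the increment of the energy
    divided by 2 dt. The dissipation absorbs the derivative part of the nonlocal term, and convexity
    bounds (W, W) by the endpoint energies. *)
Lemma step_growth L : 0 < L -> exists2 K, 0 <= K & forall dt X Y W,
  0 < dt -> continuous X -> continuous Y -> is_C1 W -> periodic W (2 * L) ->
  W = (fun x => (X x + Y x) / 2) -> step_form L dt X Y W W = 0 ->
  ip L Y Y - ip L X X <= dt * K * (ip L X X + ip L Y Y).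
Proof.
move=> L0; have [K K0 HK] := Jop_form_bound L L0.
exists K => // dt X Y W dt0 cX cY CW pW WE.
rewrite /step_form ip_transport_self// addr0.
have -> : ip L (fun x => (Y x - X x) / dt) W = (2 * dt)^-1 * (ip L Y Y - ip L X X).
  rewrite /ip -RintegralB_continuous; try exact: continuousMf.
  rewrite -RintegralZ_continuous; last by apply: continuousBf; exact: continuousMf.
  apply: eq_Rintegral => x _; rewrite WE; field.
  by rewrite gt_eqF.
have := HK W CW pW; rewrite ler_norml => /andP[_].
have := ip_mean_le L X Y cX cY; rewrite -WE.
have := ip_ge0 L (derive1 W).
move: (ip L W W) (ip L (derive1 W) _) (ip L (Jop _ _) _) (ip L X X) (ip L Y Y).
move=> w p j x y p0 wxy jp E.
have E1 : (2 * dt)^-1 * (y - x) <= K * w by lra.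
have E2 : K * w <= K * (2^-1 * (x + y)) by apply: ler_wpM2l.
have dt20 : 0 < 2 * dt by rewrite mulr_gt0.
have := le_trans E1 E2; rewrite mulrC ler_pdivrMr//; lra.
Qed.

Lemma young_transport (v b d m : R) : b ^+ 2 <= m ->
  v * b * d <= m * (v * v) + 4^-1 * (d * d).
Proof.
move=> bm; have S := sqr_ge0 (v * b - 2^-1 * d).
have B : v ^+ 2 * b ^+ 2 <= v ^+ 2 * m by rewrite ler_wpM2l// sqr_ge0.
lra.
Qed.

Lemma form_sub (a1 a2 a3 a4 b1 b2 b3 b4 : R) :
  a1 + a2 + a3 - a4 = 0 -> b1 + b2 + b3 - b4 = 0 ->
  (a1 - b1) + (a2 - b2) + (a3 - b3) - (a4 - b4) = 0.
Proof. by move=> *; lra. Qed.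

(** The budget of the dissipation [p]: the term [t] uses at most 1/4 + 1/4 of it and [j] at most
    1/2. What remains is 2 / dt * q <= (M * C + K) * q, impossible for q > 0 under the bound on
    [dt]. *)
Lemma absorb M K dt C eta (p q t j : R) : M * eta <= 4^-1 -> 0 <= p -> 0 <= q ->
  0 < dt -> dt * (M * C + K) < 2 -> t <= M * (eta * p + C * q) + 4^-1 * p ->
  j <= 2^-1 * p + K * q -> 2 / dt * q - t + p - j = 0 -> q = 0.
Proof.
move=> Meta p0 q0 dt0 dtC tb jb E.
have Mp : M * eta * p <= 4^-1 * p by apply: ler_wpM2r.
have q1 : 2 / dt * q <= (M * C + K) * q by lra.
apply/eqP; rewrite eq_le q0 andbT leNgt; apply/negP => qp.
by move: q1; rewrite ler_pM2r// ler_pdivrMr//; lra.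
Qed.

(** Turns a vanishing norm into pointwise vanishing: if (e, e) = 0, Agmon's inequality bounds e (x)
    ^ 2 by arbitrarily small multiples of (e', e'). *)
Lemma eq0_of_small (y p : R) : 0 <= p ->
  (forall dl, 0 < dl -> y ^+ 2 <= dl * p) -> y = 0.
Proof.
move=> p0 H; apply/eqP; rewrite -sqrf_eq0 eq_le sqr_ge0 andbT leNgt.
apply/negP => y0.
have d0 : 0 < y ^+ 2 / (2 * (p + 1)) by rewrite divr_gt0// mulr_gt0//; lra.
have := H _ d0; rewrite mulrAC ler_pdivlMr; last by rewrite mulr_gt0//; lra.
by have := mulr_ge0 (ltW y0) p0; lra.
Qed.

Lemma mean_inj (x y z : R) : (x + y) / 2 = (x + z) / 2 -> y = z.
Proof. by lra. Qed.

(** The difference of the two equations is tested with e = W - V. Its quadratic part reduces to the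
    integral of V e e', so an L^2 bound on [V] is enough, and the constant depends only on [L] and
    [M]. *)
Lemma step_unique L M : 0 < L -> 0 <= M -> exists2 C, 0 <= C &
  forall dt X Y Z W V, 0 < dt -> dt * C < 2 ->
  is_C1 W -> periodic W (2 * L) -> is_C1 V -> periodic V (2 * L) ->
  continuous X -> continuous Y -> continuous Z ->
  W = (fun x => (X x + Y x) / 2) -> V = (fun x => (X x + Z x) / 2) ->
  ip L V V <= M ->
  step_form L dt X Y W (fun x => W x - V x) = 0 ->
  step_form L dt X Z V (fun x => W x - V x) = 0 -> Y = Z.
Proof.
move=> L0 M0; have [K K0 HK] := Jop_form_bound L L0.
(* Ensures M * eta <= 1/4; the shift by 1 covers M = 0. *)
pose eta := (4 * (M + 1))^-1.
have M1 : 0 < M + 1 by lra.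
have eta0 : 0 < eta by rewrite invr_gt0 mulr_gt0.
have Meta : M * eta <= 4^-1.
  by rewrite /eta ler_pdivrMr ?mulr_gt0//; lra.
pose C := eta^-1 + (2 * L)^-1.
have C0 : 0 <= C by rewrite addr_ge0// invr_ge0 ?ltW// mulr_gt0.
exists (M * C + K); first by rewrite addr_ge0// mulr_ge0.
move=> dt X Y Z W V dt0 dtC CW pW CV pV cX cY cZ WE VE VM HY HZ.
pose e x := W x - V x.
have [Ce De] := C1_sub W V CW CV.
have pe : periodic e (2 * L) by move=> x; rewrite /e pW pV.
have cW := C1_continuous _ CW; have cV := C1_continuous _ CV.
have ce := C1_continuous _ Ce.
have cW' := CW.2; have cV' := CV.2; have ce' := Ce.2.
have cJW := Jop_continuous L W L0 CW pW.
have cJV := Jop_continuous L V L0 CV pV.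
set q := ip L e e; set p := ip L (derive1 e) (derive1 e).
pose t := \int[mu]_(x in `]-L, L[) (V x * e x * derive1 e x).
have cVe : continuous (fun x => V x * e x) by exact: continuousMf.
have cT : continuous (fun x => V x * e x * derive1 e x) by exact: continuousMf.
have p0 : 0 <= p := ip_ge0 _ _.
have q0 : 0 <= q := ip_ge0 _ _.
(* Both steps start from [X], so Y - Z = 2 e. *)
have D1 : ip L (fun x => (Y x - X x) / dt) e - ip L (fun x => (Z x - X x) / dt) e =
    2 / dt * q.
  have c1 (A : R -> R) : continuous A -> continuous (fun x => (A x - X x) / dt).
    by move=> cA; apply: continuousMf; [exact: continuousBf|exact: cst_continuous].
  rewrite /q /ip -RintegralB_continuous; try by apply: continuousMf => //; exact: c1.
  rewrite -RintegralZ_continuous; last exact: continuousMf.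
  apply: eq_Rintegral => x _; rewrite /e WE VE; field.
  by rewrite gt_eqF.
(* [(W W' - V V') e + V e e' = (V e ^ 2)' + (e ^ 3)' / 3] for [e = W - V]. *)
have alg (w w' v v' : R) : w * w' * (w - v) - v * v' * (w - v) +
    v * (w - v) * (w' - v') = v' * ((w - v) * (w - v)) +
    v * ((w' - v') * (w - v) + (w - v) * (w' - v')) +
    3^-1 * (((w' - v') * (w - v) + (w - v) * (w' - v')) * (w - v) +
            (w - v) * (w - v) * (w' - v')) by field.
have D2 : ip L (fun x => W x * derive1 W x) e - ip L (fun x => V x * derive1 V x) e = - t.
  have [C2 E2] := C1_mul e e Ce Ce.
  have [C3 E3] := C1_mul V _ CV C2.
  have [C4 E4] := C1_mul _ e C2 Ce.
  have := Rintegral_periodic_derivative L _ L0 C3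
    (periodicM _ _ _ pV (periodicM _ _ _ pe pe)).
  have := Rintegral_periodic_derivative L _ L0 C4
    (periodicM _ _ _ (periodicM _ _ _ pe pe) pe).
  rewrite E4 E3 E2 => I1 I2.
  have c2 := C2.2; rewrite E2 in c2.
  have c3 := C3.2; rewrite E3 E2 in c3.
  have c4 := C4.2; rewrite E4 E2 in c4.
  have cWW : continuous (fun x => W x * derive1 W x * e x).
    by apply: continuousMf => //; exact: continuousMf.
  have cVV : continuous (fun x => V x * derive1 V x * e x).
    by apply: continuousMf => //; exact: continuousMf.
  rewrite /ip -RintegralB_continuous//.
  apply/eqP; rewrite -subr_eq0 opprK; apply/eqP.
  rewrite /t -RintegralD_continuous//; last exact: continuousBf.
  (* The first zero stands for the integral of (V e ^ 2)', the second for that of (e ^ 3)'. *)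
  transitivity (0 + 3^-1 * 0 : R); last by rewrite mulr0 addr0.
  rewrite -{1}I2 -I1 -RintegralZ_continuous// -RintegralD_continuous//; last exact: continuousZf.
  apply: eq_Rintegral => x _; rewrite De /e.
  exact: alg.
have D3 : ip L (derive1 W) (derive1 e) - ip L (derive1 V) (derive1 e) = p.
  rewrite /p /ip -RintegralB_continuous; try exact: continuousMf.
  by apply: eq_Rintegral => z _; rewrite De /=; ring.
have D4 : ip L (Jop L W) (derive1 e) - ip L (Jop L V) (derive1 e) =
    ip L (Jop L e) (derive1 e).
  rewrite /ip -RintegralB_continuous; try exact: continuousMf.
  apply: eq_Rintegral => z _.
  have J := Jop_diff L W V z L0 CW pW CV pV.
  rewrite -mulrBl; congr (_ * _).
  exact: (esym J).
(* Agmon's inequality bounds e ^ 2 pointwise by [m], leaving the factor V ^ 2, whose integral is at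
   most [M]. *)
have tb : t <= M * (eta * p + C * q) + 4^-1 * p.
  pose m := eta * p + C * q.
  have cVV : continuous (fun x => V x * V x) by exact: continuousMf.
  have cee : continuous (fun x => derive1 e x * derive1 e x) by exact: continuousMf.
  have m0 : 0 <= m by rewrite addr_ge0// mulr_ge0// ltW.
  apply: (@le_trans _ _ (m * ip L V V + 4^-1 * p)); last first.
    by rewrite lerD2r mulrC ler_wpM2r.
  rewrite /p /ip -!RintegralZ_continuous// -RintegralD_continuous; try exact: continuousZf.
  apply: le_Rintegral_continuous => //.
    by apply: continuousDf; exact: continuousZf.
  move=> x; have A := agmon L e eta x L0 eta0 Ce pe.
  rewrite -/p -/q -/C -/m in A.
  exact: young_transport.
have Jb : ip L (Jop L e) (derive1 e) <= 2^-1 * p + K * q.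
  by have := HK e Ce pe; rewrite ler_norml => /andP[_].
have E : 2 / dt * q - t + p - ip L (Jop L e) (derive1 e) = 0.
  by rewrite -D1 -D2 -D3 -D4; exact: form_sub HY HZ.
have qz : q = 0 := absorb _ _ _ _ _ _ _ _ _ Meta p0 q0 dt0 dtC tb Jb E.
have ez x : e x = 0.
  apply: (eq0_of_small _ p p0) => dl dl0.
  have := agmon L e dl x L0 dl0 Ce pe.
  by rewrite -/p -/q qz mulr0 addr0.
apply/funext => x; apply: (mean_inj (X x)); move/eqP: (ez x).
by rewrite /e WE VE subr_eq0 => /eqP.
Qed.

Lemma fe_space_lin L r P (S : set (R -> R)) (a b : R) X Y : fe_space L r P S ->
  S X -> S Y -> S (fun x => a * X x + b * Y x).
Proof.
move=> [_ [d [v ->]] _ _] [cX ->] [cY ->] /=.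
exists (fun k => a * cX k + b * cY k); apply/funext => x.
rewrite !mulr_sumr -big_split/=; apply: eq_bigr => k _; ring.
Qed.

End scheme.

(** * Initial data and the discrete Gronwall inequality *)

Lemma smooth_upto_continuous (R : realType) (T : R) (m : nat) (u : R -> R -> R) :
  0 <= T -> smooth_upto T m u -> continuous (u 0).
Proof.
move=> T0 [D [D0 cD _]] x.
have -> : u 0 = D 0%N 0%N 0.
  by apply/funext => y; rewrite D0// lexx T0.
have /subspace_continuousP/(_ (0, x)) /= := cD 0%N 0%N (leq0n m).
rewrite lexx T0 => /(_ isT) H.
apply: (@cvg_comp _ _ _ (fun y : R => (0 : R, y)) (fun z => D 0%N 0%N z.1 z.2) _
  (within [set z : R * R | 0 <= z.1 <= T] (nbhs (0 : R, x)))); last exact: H.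
move=> A /= wA.
have c : (fun y : R => (0 : R, y)) @ x --> ((0 : R), x).
  exact: (cvg_pair (cvg_cst (0 : R)) (@cvg_id _ (nbhs x))).
apply: (@filterS _ (nbhs x) _ _ _ _ (c _ wA)) => y; apply.
by rewrite /= lexx T0.
Qed.

Lemma mesh_ge0 (R : realType) (L : R) (P : seq R) :
  itv_partition (- L) L P -> 0 <= mesh L P.
Proof.
move=> [/(pathP 0) sP _]; apply: (big_ind (fun y => 0 <= y)) => // [y z y0 z0|j _].
  by rewrite le_max y0.
by rewrite subr_ge0 ltW//; exact: sP.
Qed.

(** For a <= 1/2 the implicit inequality becomes explicit with factor 1 + 4 a, because (1 - a) (1 +
    4 a) - (1 + a) = 2 a (1 - 2 a) >= 0. Then 1 + 4 a <= exp (4 a). *)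
Lemma discrete_gronwall (R : realType) (x : nat -> R) (a : R) (N : nat) :
  0 <= a <= 2^-1 -> (forall n, 0 <= x n) ->
  (forall n, (n < N)%N -> x n.+1 - x n <= a * (x n + x n.+1)) ->
  forall n, (n <= N)%N -> x n <= expR (4 * a * N%:R) * x 0%N.
Proof.
move=> /andP[a0 a2] x0 H n nN.
have H1 k : (k < N)%N -> x k.+1 <= (1 + 4 * a) * x k.
  move=> kN; have Hk := H k kN; have := x0 k; have := x0 k.+1.
  move: (x k.+1) (x k) Hk => y z Hk y0 z0.
  have E : (1 - a) * y <= (1 + a) * z by lra.
  have E2 : (1 + a) * z <= (1 - a) * ((1 + 4 * a) * z).
    have : 0 <= (2 * a * (1 - 2 * a)) * z by rewrite !mulr_ge0//; lra.
    by lra.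
  have a1 : 0 < 1 - a by lra.
  by rewrite -(ler_pM2l a1); exact: le_trans E2.
have H2 k : (k <= N)%N -> x k <= (1 + 4 * a) ^+ k * x 0%N.
  elim: k => [|k IH] kN; first by rewrite expr0 mul1r.
  apply: (le_trans (H1 k kN)); rewrite exprS -mulrA ler_wpM2l//; last exact/IH/ltnW.
  by lra.
apply: (le_trans (H2 n nN)); apply: ler_wpM2r => //.
apply: (@le_trans _ _ ((expR (4 * a)) ^+ n)).
  by rewrite lerXn2r ?nnegrE ?expR_ge0//; [lra|exact: expR_ge1Dx].
rewrite -expRM_natl ler_expR mulrC ler_wpM2l ?ler_nat//; lra.
Qed.

Lemma ip_le_sub_add (R : realType) (L : R) (f g : R -> R) : continuous f -> continuous g ->
  ip L f f <= 2 * ip L (fun x => f x - g x) (fun x => f x - g x) + 2 * ip L g g.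
Proof.
move=> cf cg; have cB := continuousBf f g cf cg.
have cBB := continuousMf _ _ cB cB; have cgg := continuousMf _ _ cg cg.
rewrite /ip -!RintegralZ_continuous// -RintegralD_continuous; try exact: continuousZf.
apply: le_Rintegral_continuous; first exact: continuousMf.
- by apply: continuousDf; exact: continuousZf.
- by move=> x; have := sqr_ge0 (f x - 2 * g x); lra.
Qed.

(** * Stability and uniqueness over all time steps *)

Theorem mainTheorem5 (R : realType) (r : nat) (hr : (2 <= r)%N) :
  exists m : nat,
  forall (L T : R) (I : Type) (P : I -> seq R) (S : I -> set (R -> R))
    (u0 : R -> R) (u : R -> R -> R) (uh0 : I -> R -> R) (C0 : R),
    0 < L -> 0 < T ->
    (forall i : I, fe_space L r (P i) (S i)) ->
    approximation_property L r P S ->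
    inverse_inequality L P S ->
    periodic u0 (2 * L) ->
    is_solution L T u0 u ->
    smooth_upto T m u ->
    (forall i : I, S i (uh0 i)) ->
    (forall i : I,
       norm2 L (fun x => uh0 i x - u0 x) <= C0 * mesh L (P i) ^+ r.-1) ->
    exists2 delta : R, 0 < delta &
    forall (i : I) (N : nat), (0 < N)%N ->
      let h := mesh L (P i) in
      let dt := T / N%:R in
      dt < delta -> h < delta ->
      dt ^+ 5 * h `^ (- 2^-1) < delta ->
      dt * h `^ (2 * r%:R - 3 / 2) < delta ->
      forall U V : nat -> R -> R,
        scheme_solution L dt N (S i) (uh0 i) U ->
        scheme_solution L dt N (S i) (uh0 i) V ->
        forall n : nat, (n <= N)%N -> U n = V n.
Proof.
exists 0%N => L T I P S u0 u uh0 C0 L0 T0 fe _ _ _ [_ _ u0E] sm Suh init.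
have cu0 : continuous u0.
  by rewrite -u0E; exact: smooth_upto_continuous (ltW T0) sm.
have [K K0 HK] := step_growth L L0.
(* Bounds the energy of the discrete initial value by way of [u0]: for h < 1 the initial error is at
   most the absolute value of [C0]. *)
pose B := 2 * C0 ^+ 2 + 2 * ip L u0 u0.
have B0 : 0 <= B by rewrite addr_ge0// mulr_ge0// ?sqr_ge0// ip_ge0.
(* Gronwall's exponent 4 (dt K) N equals 4 K T because N dt = T, so [M] depends on neither h nor
   dt. *)
pose M := expR (4 * K * T) * B.
have M0 : 0 <= M by rewrite mulr_ge0// expR_ge0.
have [C C_ge0 HC] := step_unique L M L0 M0.
(* The entry 1 gives h < 1 for the initial error, the second dt K <= 1/2 for Gronwall, and the third
   dt C < 2 for uniqueness of a step. Adding 1 to [K] and [C] keeps the denominators positive. *)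
pose delta := Num.min 1 (Num.min (2 * (K + 1))^-1 (2 / (C + 1))).
have K1 : 0 < 2 * (K + 1) by lra.
have C1 : 0 < C + 1 by lra.
exists delta; first by rewrite !lt_min ltr01 invr_gt0 K1 divr_gt0.
move=> i N N0 h dt dtd hd _ _ U V HU HV.
move: dtd hd; rewrite !lt_min => /and3P[_ dtK dtC] /and3P[h1 _ _].
have N0' : 0 < N%:R :> R by rewrite ltr0n.
have dt0 : 0 < dt by rewrite divr_gt0.
have Kdt : dt * K <= 2^-1.
  move: dtK; rewrite -[X in _ < X]mul1r ltr_pdivlMr//; lra.
have Cdt : dt * C < 2.
  by move: dtC; rewrite ltr_pdivlMr//; lra.
have [/mesh_ge0 h0 _ _ Sprop] := fe i.
have SC1 X : S i X -> is_C1 X by move=> /Sprop[].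
have Sper X : S i X -> periodic X (2 * L) by move=> /Sprop[].
have Scont X : S i X -> continuous X by move=> /SC1; exact: C1_continuous.
have Shalf X Y : S i X -> S i Y -> S i (fun x => (X x + Y x) / 2).
  move=> SX SY; rewrite (_ : (fun x => _) = fun x => 2^-1 * X x + 2^-1 * Y x).
    exact: fe_space_lin (fe i) SX SY.
  by apply/funext => x; lra.
have uhB : ip L (uh0 i) (uh0 i) <= B.
  apply: (le_trans (ip_le_sub_add _ _ _ u0 (Scont _ (Suh i)) cu0)).
  rewrite lerD2r ler_pM2l//.
  rewrite -(sqr_sqrtr (ip_ge0 L (fun x => uh0 i x - u0 x))).
  rewrite -[C0 ^+ 2]real_normK ?num_real// lerXn2r ?nnegrE ?sqrtr_ge0//.
  apply: (le_trans (init i)); apply: (le_trans (ler_norm _)).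
  rewrite normrM ler_piMr// ger0_norm ?exprn_ge0 ?h0//.
  by rewrite exprn_ile1 ?h0// ltW.
have stable Z : scheme_solution L dt N (S i) (uh0 i) Z ->
    forall n, (n <= N)%N -> ip L (Z n) (Z n) <= M.
  move=> [SZ Z0 HZ] n nN.
  have SZ' k : (k < N)%N -> [/\ S i (Z k), S i (Z k.+1) & S i (half_step Z k)].
    by move=> kN; split; [exact/SZ/ltnW|exact: SZ|apply: Shalf; [exact/SZ/ltnW|exact: SZ]].
  have G := @discrete_gronwall R (fun k => ip L (Z k) (Z k)) (dt * K) N.
  apply: (le_trans (G _ _ _ n nN)).
  - by rewrite Kdt mulr_ge0// ltW.
  - by move=> k; exact: ip_ge0.
  - move=> k kN; have [S1 S2 S3] := SZ' k kN.
    apply: (HK dt _ _ (half_step Z k)) => //;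
      [exact: Scont|exact: Scont|exact: SC1|exact: Sper|exact: HZ].
  rewrite Z0 /M (_ : 4 * (dt * K) * N%:R = 4 * K * T).
    by rewrite ler_wpM2l// expR_ge0.
  by rewrite /dt; field; rewrite gt_eqF.
elim=> [|n IH] nN; first by have [_ -> _] := HU; have [_ -> _] := HV.
have [SU _ EU] := HU; have [SV _ EV] := HV.
have UV := IH (ltnW nN).
have SX := SU n (ltnW nN); have SY := SU n.+1 nN; have SZ := SV n.+1 nN.
have SW : S i (half_step U n) by exact: Shalf.
have SW' : S i (half_step V n) by rewrite /half_step -UV; exact: Shalf.
(* The space is linear, so the difference of the midpoints is an admissible test function in both
   equations. *)
have Se : S i (fun x => half_step U n x - half_step V n x).
  rewrite (_ : (fun x => _) = fun x => 1 * half_step U n x + (-1) * half_step V n x).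
    exact: fe_space_lin (fe i) SW SW'.
  by apply/funext => x; rewrite mul1r mulN1r.
apply: (HC dt (U n) (U n.+1) (V n.+1) (half_step U n) (half_step V n)) => //;
  try exact: SC1; try exact: Sper; try exact: Scont.
- by rewrite /half_step UV.
(* By convexity the midpoint inherits the bound [M] from the two iterates. *)
- have SVn := SV n (ltnW nN).
  have sV := stable V HV.
  apply: (le_trans (ip_mean_le L _ _ (Scont _ SVn) (Scont _ SZ))).
  by have := sV n (ltnW nN); have := sV n.+1 nN; lra.
- exact: EU.
- by rewrite UV; exact: EV.
Qed.
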